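(* Let $q$ be a prime power. For every integer $i$ with $0\leq i\leq q-1$, $$M_q\bigl((q-1)(q-i)+1\bigr)=q-i+2.$$
   Context: For integers $c,s\geq 1$, $K_{c\times s}$ denotes the complete multipartite graph with $c$ classes of $s$ vertices each. For a subgraph $H$ of $K_{c\times s}$, $\overline{H}$ denotes the complement of $H$ relative to $K_{c\times s}$. $C_4$ is the $4$-cycle and $K_{1,n}$ is the star with $n+1$ vertices. $M_s(n)$ is the smallest positive integer $c$ such that for every subgraph $H$ of $K_{c\times s}$, $H$ contains a copy of $C_4$ or $\overline{H}$ contains a copy of $K_{1,n}$. *)

(* Defs.v *)
From mathcomp Require Import all_boot.

Set Implicit Arguments.
Unset Strict Implicit.
Unset Printing Implicit Defensive.

(* Graphs are given by their adjacency relations. *)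

Definition complete_multipartite (c s : nat) : rel ('I_c * 'I_s) :=
  fun u v => u.1 != v.1.

Definition is_subgraph (T : Type) (H G : rel T) : Prop :=
  symmetric H /\ subrel H G.

Definition rel_complement (T : Type) (G H : rel T) : rel T :=
  fun u v => G u v && ~~ H u v.

(* Copies are not required to be induced. *)
Definition contains_copy (U T : Type) (F : rel U) (G : rel T) : Prop :=
  exists f : U -> T, injective f /\ forall u v, F u v -> G (f u) (f v).

(* [ordS] is the cyclic successor on ['I_4]. *)
Definition C4 : rel 'I_4 := fun u v => (v == ordS u) || (u == ordS v).

(* The star K_{1,n}, with centre [ord0]. *)
Definition star (n : nat) : rel 'I_n.+1 :=
  fun u v => (u == ord0) (+) (v == ord0).

Definition C4_star_arrow (s n c : nat) : Prop :=
  forall H : rel ('I_c * 'I_s),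
    is_subgraph H (@complete_multipartite c s) ->
    contains_copy C4 H \/
    contains_copy (@star n) (rel_complement (@complete_multipartite c s) H).

(* M_s(n) = m *)
Definition is_M (s n m : nat) : Prop :=
  [/\ 0 < m, C4_star_arrow s n m &
      forall c, 0 < c -> C4_star_arrow s n c -> m <= c].

Definition prime_power (q : nat) : Prop :=
  exists p k : nat, [/\ prime p, 0 < k & q = p ^ k].

(* Main.v *)
Require Import Defs.
From mathcomp Require Import all_boot.
From mathcomp Require Import ssralg finalg finfield.
From mathcomp Require Import zify ring.

Set Implicit Arguments.
Unset Strict Implicit.
Unset Printing Implicit Defensive.

Import GRing.Theory.

(** Put m = q - i, so 1 <= m <= q.

    Upper bound: if no vertex of K_{(m+2) x q} has (q-1)m + 1 neighbours in the
    complement of H, then all degrees in H are at least m + q. In a C4-free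
    graph the neighbours of a vertex v have pairwise disjoint neighbourhoods
    away from v, so (m+q)(m+q-1) is less than the number (m+2)q of vertices,
    which is absurd.

    Lower bound: take the points (a, x) of the affine plane over F_q, with
    (a, x) and (b, y) adjacent when a <> b and x + y = ab; the classes are the
    vertical lines. A last class, at infinity, consists of one vertex for each
    a, adjacent to all of the points (a, x). This graph is C4-free, and so is
    its restriction to any c <= q + 1 classes, where every vertex has at least
    c - 1 neighbours as long as the class at infinity is the last to be used. *)

(** * Stars, 4-cycles and common neighbours in a finite graph *)

Section Copies.

Variables (T : finType) (G : rel T).
Hypotheses (Gsym : symmetric G) (Girr : irreflexive G).

Lemma contains_star_degree n v :
  n <= #|[set w | G v w]| -> contains_copy (@star n) G.
Proof.
move=> le_n; pose s := enum [set w | G v w].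
have sz_s : size s = #|[set w | G v w]| by rewrite -cardE.
have Gs (j : 'I_n) : G v (nth v s j).
  have : nth v s j \in s by rewrite mem_nth // sz_s (leq_trans (ltn_ord j)).
  by rewrite mem_enum inE.
pose f (u : 'I_n.+1) := oapp (fun j : 'I_n => nth v s j) v (unlift ord0 u).
have f0 : f ord0 = v by rewrite /f unlift_none.
have fS j : f (lift ord0 j) = nth v s j by rewrite /f liftK.
exists f; split=> [u1 u2|u1 u2].
  case: (unliftP ord0 u1) => [j1|] ->; case: (unliftP ord0 u2) => [j2|] ->;
    rewrite ?fS ?f0 // => E.
  - congr (lift _ _); apply/val_inj/eqP.
    by rewrite -(nth_uniq v _ _ (enum_uniq [set w | G v w])) ?E
      // -cardE (leq_trans (ltn_ord _)).
  - by have := Gs j1; rewrite E Girr.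
  - by have := Gs j2; rewrite -E Girr.
case: (unliftP ord0 u1) => [j1|] ->; case: (unliftP ord0 u2) => [j2|] ->;
  rewrite /star ?fS ?f0 ?eqxx //= => _.
by rewrite Gsym.
Qed.

Lemma degree_contains_star n :
  contains_copy (@star n) G -> exists v, n <= #|[set w | G v w]|.
Proof.
case=> f [f_inj fG]; exists (f ord0).
have g_inj : injective (f \o lift ord0 : 'I_n -> T).
  by move=> j1 j2 /f_inj /lift_inj.
rewrite -[X in X <= _](card_ord n) -(card_codom g_inj); apply/subset_leq_card/subsetP.
by move=> _ /codomP[j ->]; rewrite inE /=; apply: fG; rewrite /star eqxx.
Qed.

(** For symmetric irreflexive [G] this amounts to having no 4-cycle; it is the form used for
    counting and for the affine graph. *)
Definition common_neighbour_unique :=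
  forall u w x y, u != w -> G u x -> G w x -> G u y -> G w y -> x = y.

Lemma contains_C4_common_neighbours u w x y :
  u != w -> x != y -> G u x -> G w x -> G u y -> G w y -> contains_copy C4 G.
Proof.
move=> uw xy ux wx uy wy.
have neq a b : G a b -> a != b by apply: contraTneq => ->; rewrite Girr.
have uniq4 : uniq [:: u; x; w; y].
  rewrite /= !inE !negb_or (neq _ _ ux) uw (neq _ _ uy) xy (neq _ _ wy).
  by rewrite eq_sym (neq _ _ wx).
exists (fun k : 'I_4 => nth u [:: u; x; w; y] k); split=> [k l E|k l].
  by apply/val_inj/eqP; rewrite -(nth_uniq u _ _ uniq4) ?E //= ltn_ord.
case: k l => [[|[|[|[|//]]]] ?] [[|[|[|[|//]]]] ?]; rewrite /C4 //= => _;
  by rewrite // Gsym.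
Qed.

Lemma contains_C4_or_common_neighbour_unique :
  contains_copy C4 G \/ common_neighbour_unique.
Proof.
case: (boolP [exists u, exists w, exists x, exists y,
  [&& u != w, x != y, G u x, G w x, G u y & G w y]]) => [|none].
  case/existsP=> u /existsP[w /existsP[x /existsP[y]]].
  case/and5P=> uw xy ux wx /andP[uy wy]; left.
  exact: contains_C4_common_neighbours uw xy ux wx uy wy.
right=> u w x y uw ux wx uy wy; apply: contraNeq none => xy.
apply/existsP; exists u; apply/existsP; exists w.
apply/existsP; exists x; apply/existsP; exists y.
by rewrite uw xy ux wx uy wy.
Qed.

Lemma common_neighbour_C4_free :
  common_neighbour_unique -> ~ contains_copy C4 G.
Proof.
move=> uniqG [f [f_inj fG]].
pose o k (lt_k : k < 4) := Ordinal lt_k.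
(* The opposite corners 0 and 2 have both 1 and 3 as common neighbours. *)
suff /f_inj : f (@o 1 isT) = f (@o 3 isT) by [].
by apply: (uniqG (f (@o 0 isT)) (f (@o 2 isT)));
  [apply/negP => /eqP /f_inj | apply: fG ..].
Qed.

(** Double count the paths v, u, w with w different from v: each neighbour u of v starts at least d
    - 1 of them, and each w ends at most one. *)
Lemma common_neighbour_unique_card d (v : T) :
  common_neighbour_unique -> (forall u, d <= #|[set w | G u w]|) ->
  d * d.-1 < #|T|.
Proof.
move=> uniqG degG.
have -> : #|T| = (\sum_(w | w != v) 1).+1.
  by rewrite sum1_card (cardC1 v) prednK //; apply/card_gt0P; exists v.
rewrite ltnS.
apply: (@leq_trans (\sum_(u | G v u) \sum_(w | (w != v) && G u w) 1)).
  apply: (@leq_trans (\sum_(u | G v u) d.-1)).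
    rewrite sum_nat_const leq_mul2r; apply/orP; right.
    by rewrite (leq_trans (degG v)) // cardsE.
  apply: leq_sum => u vu; rewrite sum1_card.
  have := degG u; rewrite (cardsD1 v) inE Gsym vu add1n => /(leq_sub2r 1).
  rewrite subn1 subSS subn0 => /leq_trans; apply.
  by rewrite -cardsE; apply/subset_leq_card/subsetP => w; rewrite !inE.
rewrite (exchange_big_dep (fun w => w != v)) /=; last by move=> u w _ /andP[].
apply: leq_sum => w wv; rewrite wv sum1_card.
apply/card_le1_eqP => x y /andP[vx xw] /andP[vy yw].
by apply: (uniqG v w) => //; rewrite 1?eq_sym // Gsym.
Qed.

End Copies.

Section Multipartite.

Variables (c s : nat) (H : rel ('I_c * 'I_s)).
Hypothesis subH : is_subgraph H (@complete_multipartite c s).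

Lemma subgraph_multipartite_irreflexive : irreflexive H.
Proof.
by move=> u; apply/negP => /(proj2 subH); rewrite /complete_multipartite eqxx.
Qed.

Lemma rel_complement_symmetric :
  symmetric (rel_complement (@complete_multipartite c s) H).
Proof.
move=> u v; rewrite /rel_complement /complete_multipartite eq_sym.
by rewrite (proj1 subH).
Qed.

Lemma rel_complement_irreflexive :
  irreflexive (rel_complement (@complete_multipartite c s) H).
Proof. by move=> u; rewrite /rel_complement /complete_multipartite eqxx. Qed.

Lemma card_rel_complement v :
  #|[set w | H v w]|
    + #|[set w | rel_complement (@complete_multipartite c s) H v w]|
  = c.-1 * s.
Proof.
have <- : #|[set w : 'I_c * 'I_s | v.1 != w.1]| = c.-1 * s.
  have -> : [set w : 'I_c * 'I_s | v.1 != w.1] = setX (~: [set v.1]) setT.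
    by apply/setP => w; rewrite !inE andbT eq_sym.
  by rewrite cardsX cardsT cardsC1 !card_ord.
rewrite -(cardsID [set w | H v w] [set w | v.1 != w.1]).
congr (_ + _); apply: eq_card => w; rewrite !inE; last by rewrite andbC.
by case Hvw: (H v w); rewrite ?andbF // andbT; apply/esym/(proj2 subH).
Qed.

End Multipartite.

(** * The upper bound *)

Lemma C4_star_arrow_upper q m :
  1 < q -> 0 < m -> m <= q -> C4_star_arrow q ((q - 1) * m + 1) (m + 2).
Proof.
move=> q1 m0 mq H subH; set n := (q - 1) * m + 1.
have [Hsym _] := subH; have Hirr := subgraph_multipartite_irreflexive subH.
set K := rel_complement _ H.
case: (boolP [exists v, n <= #|[set w | K v w]|]) => [/existsP[v le_n]|].
  right; apply: contains_star_degree le_n.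
    exact: rel_complement_symmetric.
  exact: rel_complement_irreflexive.
rewrite negb_exists => /forallP small; left.
have [//|uniqH] := contains_C4_or_common_neighbour_unique Hsym Hirr.
(* At most (q - 1)m of the (m + 1)q vertices in the other classes are neighbours in [K]. *)
have degH u : m + q <= #|[set w | H u w]|.
  have := card_rel_complement subH u; have := small u.
  by rewrite -/K /n -ltnNge; nia.
have m2 : 0 < m + 2 by rewrite addn2.
have v : 'I_(m + 2) * 'I_q := (Ordinal m2, Ordinal (ltnW q1)).
have := common_neighbour_unique_card Hsym v uniqH degH.
(* Here m + q - 1 >= q and m + q >= m + 2, so (m + q)(m + q - 1) >= (m + 2)q. *)
rewrite card_prod !card_ord; nia.
Qed.

(** * The affine graph with its class at infinity *)

Section AffineGraph.

Variable F : finFieldType.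
Local Open Scope ring_scope.

(* [None] is the class at infinity. *)
Definition affine_adj (u v : option F * F) : bool :=
  match u.1, v.1 with
  | Some a, Some b => (a != b) && (u.2 + v.2 == a * b)
  | Some a, None => v.2 == a
  | None, Some b => u.2 == b
  | None, None => false
  end.

Lemma affine_adj_sym : symmetric affine_adj.
Proof.
by move=> [[a|] x] [[b|] y] //=; rewrite /affine_adj /= eq_sym addrC mulrC.
Qed.

Lemma affine_adj_class u v : affine_adj u v -> u.1 != v.1.
Proof. by case: u v => [[a|] x] [[b|] y] //= /andP[]. Qed.

Lemma affine_adj_common_neighbour_unique : common_neighbour_unique affine_adj.
Proof.
move=> [[a|] x] [[b|] y] [[c|] z] [[d|] t]; rewrite /affine_adj //=.
- move=> uw /andP[_ /eqP E1] /andP[_ /eqP E2] /andP[_ /eqP E3] /andP[_ /eqP E4].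
  (* One of the two pairs lies in a single class. Since a point has at most one neighbour on a given
     vertical line, that pair then coincides. *)
  have E : (a - b) * (c - d) = 0.
    have -> : (a - b) * (c - d) = a * c - b * c - (a * d - b * d) by ring.
    by rewrite -E1 -E2 -E3 -E4; ring.
  move/eqP: E; rewrite mulf_eq0 !subr_eq0 => /orP[/eqP ab|/eqP cd].
    case/negP: uw; rewrite ab in E1 *; apply/eqP; congr (_, _).
    by apply: (addIr z); rewrite E1 E2.
  by rewrite cd in E1 *; congr (_, _); apply: (addrI x); rewrite E1 E3.
(* A common neighbour at infinity forces a = b. *)
- move=> uw /andP[_ /eqP E1] /andP[_ /eqP E2] /eqP E3 /eqP E4.
  case/negP: uw; apply/eqP; rewrite -E3 -E4 in E1 E2 *; congr (_, _).
  by apply: (addIr z); rewrite E1 E2.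
- move=> uw /eqP E3 /eqP E4 /andP[_ /eqP E1] /andP[_ /eqP E2].
  case/negP: uw; apply/eqP; rewrite -E3 -E4 in E1 E2 *; congr (_, _).
  by apply: (addIr t); rewrite E1 E2.
- by move=> _ /eqP -> _ /eqP ->.
(* The vertex labelled y at infinity sees only the line y, so c = d = y. *)
- move=> _ /andP[_ /eqP E1] /eqP E2 /andP[_ /eqP E3] /eqP E4.
  rewrite -E2 in E1 *; rewrite -E4 in E3 *; congr (_, _).
  by apply: (addrI x); rewrite E1 E3.
- move=> _ /eqP E2 /andP[_ /eqP E1] /eqP E4 /andP[_ /eqP E3].
  rewrite -E2 in E1 *; rewrite -E4 in E3 *; congr (_, _).
  by apply: (addrI y); rewrite E1 E3.
- by move=> uw /eqP xc /eqP yc; rewrite xc yc eqxx in uw.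
Qed.

End AffineGraph.

(** * Restriction to c classes, and the lower bound *)

Section AffineMultipartite.

Variables (F : finFieldType) (c q : nat).
Hypotheses (cardF : #|F| = q) (le_c : c <= q.+1).

Let g (x : 'I_q) : F := enum_val (cast_ord (esym cardF) x).
Let g' (a : F) : 'I_q := cast_ord cardF (enum_rank a).

Let gK : cancel g g'.
Proof. by move=> x; rewrite /g /g' enum_valK cast_ordKV. Qed.

Let g'K : cancel g' g.
Proof. by move=> a; rewrite /g /g' cast_ordK enum_rankK. Qed.

(* Class [q], if present, is sent to infinity. *)
Let e (k : 'I_c) : option F := omap g (insub (val k)).

Let e_inj : injective e.
Proof.
move=> k l; rewrite /e.
case: insubP => [x _ xk|nk]; case: insubP => [y _ yl|nl] //=.
  by case=> /(can_inj gK) xy; apply: val_inj; rewrite /= -xk -yl xy.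
rewrite /= in nk nl *; move=> _; apply: val_inj => /=.
by have := ltn_ord k; have := ltn_ord l; lia.
Qed.

(** Infinity is used only when every vertical line is present, which gives its vertices their full
    degree q. *)
Let e_None k : e k = None -> c = q.+1.
Proof.
rewrite /e; case: insubP => //= nk _; rewrite /= in nk.
by have := ltn_ord k; lia.
Qed.

Let e_Some (a : F) (lt_a : g' a < c) : e (Ordinal lt_a) = Some a.
Proof. by rewrite /e (valK (g' a)) /= g'K. Qed.

Definition affine_multipartite : rel ('I_c * 'I_q) :=
  fun u v => affine_adj (e u.1, g u.2) (e v.1, g v.2).

Lemma affine_multipartite_subgraph :
  is_subgraph affine_multipartite (@complete_multipartite c q).
Proof.
split=> [u v|u v /affine_adj_class]; first exact: affine_adj_sym.
by apply: contraNneq => /= ->.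
Qed.

Lemma affine_multipartite_C4_free : ~ contains_copy C4 affine_multipartite.
Proof.
pose f (u : 'I_c * 'I_q) := (e u.1, g u.2).
have f_inj : injective f.
  by move=> [k x] [l y] [/e_inj /= -> /(can_inj gK) ->].
apply: common_neighbour_C4_free => u w x y uw ux wx uy wy; apply: (f_inj).
apply: affine_adj_common_neighbour_unique ux wx uy wy.
by rewrite (inj_eq f_inj).
Qed.

Lemma affine_multipartite_degree v :
  c.-1 <= #|[set w | affine_multipartite v w]|.
Proof.
case: v => k x; case ek : (e k) => [a|].
  (* The neighbour in class [l]: solve x + y = ab on the line b, or take the vertex labelled a at
     infinity. *)
  pose h l : 'I_c * 'I_q :=
    (l, g' (if e l is Some b then (a * b - g x)%R else a)).
  have h_inj : injective h by move=> l l' [].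
  have <- : #|[set~ k]| = c.-1 by rewrite cardsC1 card_ord.
  rewrite -(card_imset _ h_inj).
  apply/subset_leq_card/subsetP => _ /imsetP[l lk ->].
  rewrite !inE in lk *; rewrite /affine_multipartite /h /= ek g'K.
  case el : (e l) => [b|]; rewrite /affine_adj /= ?eqxx //.
  rewrite addrC subrK eqxx andbT; apply: contraNneq lk => ab.
  by apply/eqP/e_inj; rewrite el ek ab.
(* A vertex at infinity is adjacent to all q = c - 1 points of one line. *)
have cq := e_None ek.
have lt_gx : g' (g x) < c by rewrite cq ltnS ltnW.
pose h y : 'I_c * 'I_q := (Ordinal lt_gx, y).
have h_inj : injective h by move=> y y' [].
rewrite [X in X.-1 <= _]cq /= -[X in X <= _](card_ord q) -cardsT.
rewrite -(card_imset _ h_inj).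
apply/subset_leq_card/subsetP => _ /imsetP[y _ ->].
by rewrite inE /affine_multipartite /affine_adj /= ek e_Some /= eqxx.
Qed.

(** Degrees in the complement are at most (c - 1)q - (c - 1) = (c - 1)(q - 1). *)
Lemma C4_star_arrow_lower n : c.-1 * q.-1 < n -> ~ C4_star_arrow q n c.
Proof.
move=> lt_n /(_ _ affine_multipartite_subgraph) [|].
  exact: affine_multipartite_C4_free.
case/degree_contains_star => v.
have := card_rel_complement affine_multipartite_subgraph v.
have := affine_multipartite_degree v.
have := leq_ltn_trans (leq0n v.2) (ltn_ord v.2).
nia.
Qed.

End AffineMultipartite.

Theorem theoremD (q : nat) (hq : prime_power q) (i : nat) (hi : i <= q - 1) :
  is_M q ((q - 1) * (q - i) + 1) (q - i + 2).
Proof.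
case: hq => p [k [p_prime k_gt0 q_def]].
have q_gt1 : 1 < q by rewrite q_def -(exp1n k) ltn_exp2r ?prime_gt1.
have [F _ cardF] := PrimePowerField p_prime k_gt0.
rewrite -q_def in cardF.
split=> [||c c_gt0]; first by rewrite addn2.
  apply: C4_star_arrow_upper => //; lia.
apply: contraPT; rewrite -ltnNge => lt_c.
(* From c <= q - i + 1 come both c <= q + 1 and (c - 1)(q - 1) <= (q - 1)(q - i). *)
apply: (C4_star_arrow_lower cardF); nia.
Qed.
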